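(* Let $\mathbb{K}$ be a symmetric cone in a finite-dimensional real inner product space $(\mathbb{E},\bullet)$, and suppose that the rank of $\mathbb{K}$ is at least $5$. Let $\Delta=\{\delta_1,\dots,\delta_5\}$ be a set whose elements are pairwise orthogonal (i.e. $\delta_i\bullet\delta_j=0$ for $i\neq j$) and each generate an extreme ray of $\mathbb{K}$. Then the Horn transformation $$H_\Delta=\sum_{i=1}^5\delta_i\otimes\delta_i-\sum_{i=1}^5(\delta_i\otimes\delta_{i\dotplus 1}+\delta_{i\dotplus 1}\otimes\delta_i)+\sum_{i=1}^5(\delta_i\otimes\delta_{i\dotplus 2}+\delta_{i\dotplus 2}\otimes\delta_i),$$ where $\dotplus$ denotes addition modulo $5$ on $\{1,\dots,5\}$, generates an exposed ray of the copositive cone $\mathcal{COP}(\mathbb{K})$.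
   Context: A subset $K$ of a real vector space is a cone if $ax\in K$ for all $a\ge 0$, $x\in K$. A closed cone $\mathbb{K}$ in a finite-dimensional real inner product space $(\mathbb{E},\bullet)$ is a symmetric cone if it is self-dual ($\mathbb{K}=\{x\in\mathbb{E}\mid x\bullet y\ge 0\ \forall y\in\mathbb{K}\}$) and homogeneous (for any interior points $x,y$ of $\mathbb{K}$ there is an invertible linear $G:\mathbb{E}\to\mathbb{E}$ with $G(\mathbb{K})=\mathbb{K}$ and $G(x)=y$). Rank. A Jordan algebra is a finite-dimensional real vector space with a commutative bilinear product $\circ$ satisfying $x\circ(x^2\circ y)=x^2\circ(x\circ y)$, where $x^2:=x\circ x$; it is assumed to have a unit element. It is Euclidean if it has an inner product $\bullet$ that is associative: $(x\circ y)\bullet z=x\bullet(y\circ z)$. For every symmetric cone $\mathbb{K}$ in $(\mathbb{E},\bullet)$ there is a product $\circ$ on $\mathbb{E}$, unique up to Jordan algebra isomorphism, making $(\mathbb{E},\circ,\bullet)$ a Euclidean Jordan algebra with $\mathbb{E}_+:=\{x^2\mid x\in\mathbb{E}\}=\mathbb{K}$. An idempotent is $c$ with $c^2=c$; it is primitive if it is nonzero and not a sum of two nonzero idempotents; idempotents $c_1,\dots,c_k$ are orthogonal if $c_i\circ c_j=0$ for $i\ne j$. A Jordan frame is a set $\{c_1,\dots,c_r\}$ of orthogonal primitive idempotents whose sum is the unit element; the number $r$ does not depend on the frame and is the rank of $\mathbb{E}$. The rank of $\mathbb{K}$ is the rank of its associated Euclidean Jordan algebra. For $a,b\in\mathbb{E}$,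 $a\otimes b$ denotes the linear transformation $x\mapsto(b\bullet x)a$. $\mathcal{S}(\mathbb{E})$ is the space of self-adjoint linear transformations on $\mathbb{E}$ with the trace inner product $\langle\cdot,\cdot\rangle$, and $\mathcal{COP}(\mathbb{K}):=\{A\in\mathcal{S}(\mathbb{E})\mid x\bullet A(x)\ge 0\ \forall x\in\mathbb{K}\}$. Addition modulo $5$ takes values in $\{1,\dots,5\}$, e.g. $4\dotplus 2=1$. For a closed convex cone $K$ in an inner product space: a nonzero $x\in K$ generates an extreme ray $\mathbb{R}_+x=\{ax\mid a\ge 0\}$ of $K$ if, whenever $a,b\in K$ satisfy $a+b\in\mathbb{R}_+x$, one has $a,b\in\mathbb{R}_+x$; a nonzero $x\in K$ generates an exposed ray $\mathbb{R}_+x$ of $K$ if there is an element $d$ of the dual cone of $K$ (the set of elements having nonnegative inner product with every element of $K$) with $\mathbb{R}_+x=K\cap\{d\}^\perp$. *)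

(* Defs.v *)
From HB Require Import structures.
From mathcomp Require Import all_boot all_order all_algebra sesquilinear.
From mathcomp Require Import boolp classical_sets reals.

Set Implicit Arguments.
Unset Strict Implicit.
Unset Printing Implicit Defensive.

Import Order.TTheory GRing.Theory Num.Theory.

Local Open Scope classical_set_scope.
Local Open Scope ring_scope.

(* A finite-dimensional real inner product space is a pair of E : vectType R
   and dot : {dot E for idfun}, i.e. a symmetric (the conjugation is idfun)
   positive definite bilinear form on E. *)

(* A vectType carries no canonical topology: interior and closed refer to the
   metric of dot, whose open ball of radius e is given by squared distances. *)
Definition dot_ball (R : realType) (E : vectType R) (dot : {dot E for idfun})
    (x : E) (e : R) : set E :=
  [set y | dot (y - x) (y - x) < e ^+ 2].

Definition dot_interior (R : realType) (E : vectType R)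
    (dot : {dot E for idfun}) (K : set E) : set E :=
  [set x | exists2 e : R, 0 < e & dot_ball dot x e `<=` K].

Definition dot_closed (R : realType) (E : vectType R)
    (dot : {dot E for idfun}) (K : set E) : Prop :=
  dot_interior dot (~` K) = ~` K.

Definition cone (R : realType) (V : lmodType R) (K : set V) : Prop :=
  forall (a : R) (x : V), 0 <= a -> K x -> K (a *: x).

(* The ambient space is the subspace S of V: for cones of self-adjoint
   transformations, V is 'End(E) and S is S(E). *)
Definition dual_cone (R : realType) (V : lmodType R) (S : set V)
    (ip : V -> V -> R) (K : set V) : set V :=
  [set d | S d /\ forall x, K x -> 0 <= ip d x].

Definition ray (R : realType) (V : lmodType R) (x : V) : set V :=
  [set y | exists2 a : R, 0 <= a & y = a *: x].

Definition generates_extreme_ray (R : realType) (V : lmodType R)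
    (K : set V) (x : V) : Prop :=
  [/\ x != 0, K x
    & forall a b : V, K a -> K b -> ray x (a + b) -> ray x a /\ ray x b].

Definition generates_exposed_ray (R : realType) (V : lmodType R) (S : set V)
    (ip : V -> V -> R) (K : set V) (x : V) : Prop :=
  [/\ x != 0, K x
    & exists2 d : V, dual_cone S ip K d & ray x = K `&` [set y | ip d y = 0]].

Definition self_dual (R : realType) (E : vectType R) (dot : {dot E for idfun})
    (K : set E) : Prop :=
  K = dual_cone setT dot K.

Definition homogeneous_cone (R : realType) (E : vectType R)
    (dot : {dot E for idfun}) (K : set E) : Prop :=
  forall x y : E, dot_interior dot K x -> dot_interior dot K y ->
  exists G : 'End(E), [/\ bijective G, G @` K = K & G x = y].

Definition symmetric_cone (R : realType) (E : vectType R)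
    (dot : {dot E for idfun}) (K : set E) : Prop :=
  [/\ cone K, dot_closed dot K, self_dual dot K & homogeneous_cone dot K].

Definition jordan_product (R : realType) (E : vectType R)
    (jp : {bilinear E -> E -> E}) : Prop :=
  (forall x y : E, jp x y = jp y x) /\
  (forall x y : E, jp x (jp (jp x x) y) = jp (jp x x) (jp x y)).

Definition jordan_unit (R : realType) (E : vectType R)
    (jp : {bilinear E -> E -> E}) (e : E) : Prop :=
  forall x : E, jp e x = x /\ jp x e = x.

Definition associative_dot (R : realType) (E : vectType R)
    (dot : {dot E for idfun}) (jp : {bilinear E -> E -> E}) : Prop :=
  forall x y z : E, dot (jp x y) z = dot x (jp y z).

Definition euclidean_jordan_algebra (R : realType) (E : vectType R)
    (dot : {dot E for idfun}) (jp : {bilinear E -> E -> E}) (e : E) : Prop :=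
  [/\ jordan_product jp, jordan_unit jp e & associative_dot dot jp].

Definition idempotent_elt (R : realType) (E : vectType R)
    (jp : {bilinear E -> E -> E}) (c : E) : Prop :=
  jp c c = c.

Definition primitive_idempotent (R : realType) (E : vectType R)
    (jp : {bilinear E -> E -> E}) (c : E) : Prop :=
  [/\ idempotent_elt jp c, c != 0
    & ~ exists a b : E, [/\ idempotent_elt jp a, idempotent_elt jp b,
                           a != 0, b != 0 & c = a + b]].

(* Such a family is injective, as orthogonal nonzero idempotents differ; so r
   is the number of elements of the frame. *)
Definition jordan_frame (R : realType) (E : vectType R)
    (jp : {bilinear E -> E -> E}) (e : E) (r : nat) (c : 'I_r -> E) : Prop :=
  [/\ forall i : 'I_r, primitive_idempotent jp (c i),
      forall i j : 'I_r, i != j -> jp (c i) (c j) = 0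
    & \sum_(i < r) c i = e].

(* r is the rank of K. The product associated with a symmetric cone K exists
   and is unique up to isomorphism, and the size of a Jordan frame does not
   depend on the frame, so exactly one r qualifies. *)
Definition cone_rank (R : realType) (E : vectType R) (dot : {dot E for idfun})
    (K : set E) (r : nat) : Prop :=
  exists (jp : {bilinear E -> E -> E}) (e : E),
    [/\ euclidean_jordan_algebra dot jp e,
        [set jp x x | x in setT] = K
      & exists c : 'I_r -> E, jordan_frame jp e c].

Definition self_adjoint (R : realType) (E : vectType R)
    (dot : {dot E for idfun}) : set 'End(E) :=
  [set A | forall x y : E, dot (A x) y = dot x (A y)].

(* The trace does not depend on the basis. *)
Definition trace_dot (R : realType) (E : vectType R) (A B : 'End(E)) : R :=
  \tr (passmx.mxof (vbasis {:E}) (vbasis {:E}) (A \o B)%VF).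

Definition copositive_cone (R : realType) (E : vectType R)
    (dot : {dot E for idfun}) (K : set E) : set 'End(E) :=
  [set A | self_adjoint dot A /\ forall x : E, K x -> 0 <= dot x (A x)].

Definition tensor (R : realType) (E : vectType R) (dot : {dot E for idfun})
    (a b : E) : 'End(E) :=
  linfun (fun x => dot b x *: a).

(* linfun f is f itself only when f is linear. *)
Lemma tensorE (R : realType) (E : vectType R) (dot : {dot E for idfun})
    (a b x : E) : tensor dot a b x = dot b x *: a.
Proof.
pose f y := dot b y *: a.
have f_lin : linear f.
  by move=> k u v; rewrite /f linearDr linearZr_LR /= scalerDl scalerA.
pose fL := GRing.isLinear.Build R E E *:%R f f_lin.
pose fP : {linear E -> E} := HB.pack f fL.
exact: (lfunE fP).
Qed.

(* The indices 1, ..., 5 are represented by their residues modulo 5. *)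
Definition horn (R : realType) (E : vectType R) (dot : {dot E for idfun})
    (delta : 'Z_5 -> E) : 'End(E) :=
  \sum_(i : 'Z_5) tensor dot (delta i) (delta i)
  - \sum_(i : 'Z_5) (tensor dot (delta i) (delta (i + 1))
                     + tensor dot (delta (i + 1)) (delta i))
  + \sum_(i : 'Z_5) (tensor dot (delta i) (delta (i + 2))
                     + tensor dot (delta (i + 2)) (delta i)).

(* Main.v *)
Require Import Defs.
From mathcomp Require Import all_boot all_order all_algebra sesquilinear.
From mathcomp Require Import boolp classical_sets reals.
From mathcomp Require Import ring lra.

Import Order.TTheory GRing.Theory Num.Theory.

Set Implicit Arguments.
Unset Strict Implicit.
Unset Printing Implicit Defensive.

Local Open Scope classical_set_scope.
Local Open Scope ring_scope.

(** The cone K is the set of squares of a Euclidean Jordan algebra, and a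
    generator of an extreme ray of K is a positive multiple of an idempotent c
    whose Peirce space E_1(c) is the line through c [extreme_ray_primitive].
    So the deltas are multiples of orthogonal idempotents c_0, ..., c_4.  Write
    y_i for the inner product of delta_i and x.  The value of the Horn
    transformation H at x is the classical Horn form of y; as y >= 0 on K, H is
    copositive.

    For the exposing functional take d = the sum of z (x) z over finitely many
    zeros z of H in K such that these tensors span all z (x) z.  Since
    <z (x) z, A> is the value of A at z, d is nonnegative on copositive A, and
    <d, A> = 0 means that A vanishes at every zero of H in K.  It remains to
    show that such an A is a multiple of H [horn_zeros_determine].

    Let V_a [face_span a] be the space of the x killed by c_a and c_(a+1), that
    is, the span of the face of K orthogonal to delta_a and delta_(a+1).  On V_a
    the Horn form is the square of the linear form y_(a+2) - y_(a+3) + y_(a+4),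
    so the zeros of H in this face form the intersection of the face with a
    hyperplane of V_a, and this intersection contains an interior point of the
    face.  At a zero p the form of A attains its minimum 0 over K, so A p lies
    in the dual cone, which is K, and is orthogonal to p.  If p is interior to
    the face, A p then lies in the complementary face, the one spanned by
    E_1(c_a + c_(a+1)).  Hence A maps the hyperplane of V_a into
    E_1(c_a + c_(a+1)) [copositive_face_annihilating], and so does H.

    Put D = A - alpha H, with alpha chosen so that D has a zero entry at c_0.
    The facial property, applied to the few zeros of H in the span of the c_i,
    gives D = 0 on that span: the entries vanish one after the other, and the
    relation D g_a = - D g_(a+1) goes round a cycle of odd length.  Therefore
    D maps all of V_a into E_1(c_a + c_(a+1)).  For x in V_a and V_(a+1), D x
    lies in E_1(c_a + c_(a+1)) and E_1(c_(a+1) + c_(a+2)), whose intersection is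
    the line through c_(a+1), and D x is orthogonal to c_(a+1) by symmetry; so
    D x = 0.  For x in V_a alone, D x lies in V_(a+2) and V_(a+3), so
    D (D x) = 0, and D x = 0 by symmetry again.  Finally E is spanned by the
    joint eigenvectors of the multiplications by the c_i; for each of them at
    most two of the five eigenvalues are nonzero, and two positions on a
    5-cycle always leave two adjacent ones free, so each lies in some V_a.
    Hence D = 0 [face_annihilating_eq0]. *)

(** * Bilinear estimates in a finite-dimensional inner product space *)

Section InnerProduct.
Variables (R : realType) (E : vectType R) (dot : {dot E for idfun}).
Implicit Types (a : R) (u v w x y : E).

Lemma dotC x y : dot x y = dot y x.
Proof. by have := @hermC _ _ _ _ dot x y; rewrite expr0 mul1r. Qed.

Lemma dotDl x y v : dot (x + y) v = dot x v + dot y v.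
Proof. exact: linearDl. Qed.

Lemma dotDr v x y : dot v (x + y) = dot v x + dot v y.
Proof. exact: linearDr. Qed.

Lemma dotZl a x v : dot (a *: x) v = a * dot x v.
Proof. exact: linearZl_LR. Qed.

Lemma dotZr a v x : dot v (a *: x) = a * dot v x.
Proof. exact: linearZr_LR. Qed.

Lemma dotNl x v : dot (- x) v = - dot x v.
Proof. exact: linearNl. Qed.

Lemma dotNr v x : dot v (- x) = - dot v x.
Proof. exact: linearNr. Qed.

Lemma dot0l v : dot 0 v = 0.
Proof. exact: linear0l. Qed.

Lemma dot0r v : dot v 0 = 0.
Proof. exact: linear0r. Qed.

Definition dotE :=
  (dotDl, dotDr, dotZl, dotZr, dotNl, dotNr, dot0l, dot0r).

Lemma dot_gt0 x : x != 0 -> 0 < dot x x.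
Proof. exact: (@neq0_dnorm_gt0 _ _ _ dot). Qed.

Lemma dot_ge0 x : 0 <= dot x x.
Proof. by have [->|/dot_gt0/ltW//] := eqVneq x 0; rewrite dot0l. Qed.

Lemma dot_eq0 x : dot x x = 0 -> x = 0.
Proof. by move=> h; apply/eqP; apply: contra_eqT h => /dot_gt0; case: ltgtP. Qed.

(** Vector identities are proved by testing against all w: both sides become
    real expressions, which ring and linear arithmetic can compare. *)
Lemma dot_ext u v : (forall w, dot u w = dot v w) -> u = v.
Proof.
move=> h; apply/eqP; rewrite -subr_eq0; apply/eqP/dot_eq0.
by rewrite dotDl dotNl h subrr.
Qed.

Lemma dot_sumr (I : Type) (s : seq I) (P : pred I) (F : I -> E) v :
  dot v (\sum_(i <- s | P i) F i) = \sum_(i <- s | P i) dot v (F i).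
Proof. exact: linear_sumr. Qed.

(** The Gram operator of the basis, x |-> sum of (b_j . x) b_j, is injective and
    hence invertible; the preimage of b_i represents the i-th coordinate. *)
Lemma dot_coord_representable (b := vbasis {:E}) i :
  exists r, forall u, dot r u = coord b i u.
Proof.
pose T := (\sum_(j < \dim {:E}) tensor dot b`_j b`_j) : 'End(E).
have bb : basis_of {:E} b by exact: vbasisP.
have TE x : T x = \sum_(j < \dim {:E}) dot b`_j x *: b`_j.
  by rewrite sum_lfunE; apply: eq_bigr => j _; rewrite tensorE.
have Tker : lker T == 0%VS.
  apply/lker0P => x y Txy; apply/eqP; rewrite -subr_eq0; apply/eqP.
  have : T (x - y) = 0 by rewrite linearB /= Txy subrr.
  rewrite TE => Txy0; have /freeP/(_ _ Txy0) h0 := basis_free bb.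
  apply: dot_eq0; rewrite {2}(coord_basis bb (memvf (x - y))) dot_sumr big1 // => j _.
  by rewrite dotZr dotC h0 mulr0.
exists (T^-1 b`_i)%VF => u.
have := lker0_lfunVK Tker b`_i; set r := (T^-1 b`_i)%VF => Tr.
rewrite {1}(coord_basis bb (memvf u)) dot_sumr.
have rj (j : 'I_(\dim {:E})) : dot r b`_j = (i == j)%:R.
  have := congr1 (coord b j) Tr; rewrite TE.
  by rewrite coord_sum_free ?(basis_free bb) // coord_free ?(basis_free bb) // dotC eq_sym.
rewrite (bigD1 i) //= dotZr rj eqxx mulr1 big1 ?addr0 // => j ji.
by rewrite dotZr rj eq_sym (negPf ji) mulr0.
Qed.

Lemma dot_young x y u : dot x u * dot y u <= (dot x x + dot y y) / 2 * dot u u.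
Proof.
have cs z : dot z u ^+ 2 <= dot z z * dot u u.
  have [->|/dot_gt0 u0] := eqVneq u 0; first by rewrite !dot0r expr0n /= mulr0.
  have := dot_ge0 (dot u u *: z - dot z u *: u).
  rewrite !dotE (dotC u z) => h; nra.
have := sqr_ge0 (dot x u - dot y u); have := cs x; have := cs y; nra.
Qed.

(** Expanding one copy of u in the basis turns the form into a sum of products
    of two linear forms in u, each bounded by Cauchy-Schwarz. *)
Lemma quadratic_form_bounded (f : {linear E -> E}) :
  exists2 B, 0 < B & forall u, dot (f u) u <= B * dot u u.
Proof.
pose b := vbasis {:E}.
have bb : basis_of {:E} b by exact: vbasisP.
have [r hr] := choice dot_coord_representable.
pose C i := (dot (r i) (r i) + dot (f b`_i) (f b`_i)) / 2.
have C0 i : 0 <= C i by rewrite divr_ge0 // addr_ge0 // dot_ge0.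
exists (\sum_i C i + 1); first by rewrite ltr_wpDl // sumr_ge0.
move=> u; apply: (@le_trans _ _ (\sum_i C i * dot u u)); last first.
  by rewrite -mulr_suml mulrDl mul1r lerDl dot_ge0.
rewrite {1}(coord_basis bb (memvf u)) linear_sum dotC dot_sumr.
apply: ler_sum => i _; rewrite linearZ /= dotZr -hr.
by rewrite (dotC u (f _)); apply: dot_young.
Qed.

(** With B a bound of the form of f, positivity at B x - f x gives
    B^2 (fx.x) - 2 B |fx|^2 + (f fx).fx >= 0, and the last term is at most
    B |fx|^2. *)
Lemma psd_square_bounded (f : {linear E -> E}) :
  (forall x y, dot (f x) y = dot x (f y)) -> (forall x, 0 <= dot (f x) x) ->
  exists2 B, 0 < B & forall x, dot (f x) (f x) <= B * dot (f x) x.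
Proof.
move=> fs fp; have [B B0 hB] := quadratic_form_bounded f; exists B => // x.
have := fp (B *: x - f x); rewrite (linearB f) (linearZ_LR f) /=.
rewrite !dotE (fs (f x) x) => h; have := hB (f x) => h2.
rewrite -(ler_pM2l B0); nra.
Qed.

Lemma psd_kernel (f : {linear E -> E}) :
  (forall x y, dot (f x) y = dot x (f y)) -> (forall x, 0 <= dot (f x) x) ->
  forall x, dot (f x) x = 0 -> f x = 0.
Proof.
move=> fs fp x fx0; have [B _ /(_ x)] := psd_square_bounded fs fp.
rewrite fx0 mulr0 => h; apply: dot_eq0; have := dot_ge0 (f x); lra.
Qed.
End InnerProduct.

(** * Peirce theory of one idempotent *)

Section Jordan.
Variables (R : realType) (E : vectType R) (dot : {dot E for idfun}).
Variables (jp : {bilinear E -> E -> E}) (e : E).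
Hypothesis jordan : euclidean_jordan_algebra dot jp e.
Implicit Types (a : R) (u v w x y z c : E).
Local Notation "x ** y" := (jp x y) (at level 40, left associativity).

Lemma jpC x y : x ** y = y ** x.
Proof. by have [[h _] _ _] := jordan; apply: h. Qed.

Lemma jordan_id x y : x ** ((x ** x) ** y) = (x ** x) ** (x ** y).
Proof. by have [[_ h] _ _] := jordan; apply: h. Qed.

Lemma jp1l x : e ** x = x.
Proof. by have [_ h _] := jordan; case: (h x). Qed.

Lemma dotA x y z : dot (x ** y) z = dot x (y ** z).
Proof. by have [_ _ h] := jordan; apply: h. Qed.

Lemma jp_sym c x y : dot (c ** x) y = dot x (c ** y).
Proof. by rewrite jpC dotA. Qed.

Lemma jpDl x y v : (x + y) ** v = x ** v + y ** v.
Proof. exact: linearDl. Qed.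
Lemma jpDr v x y : v ** (x + y) = v ** x + v ** y.
Proof. exact: linearDr. Qed.
Lemma jpZl a x v : (a *: x) ** v = a *: (x ** v).
Proof. exact: linearZl_LR. Qed.
Lemma jpZr a v x : v ** (a *: x) = a *: (v ** x).
Proof. exact: linearZr_LR. Qed.
Lemma jpNl x v : (- x) ** v = - (x ** v).
Proof. exact: linearNl. Qed.
Lemma jpNr v x : v ** (- x) = - (v ** x).
Proof. exact: linearNr. Qed.
Lemma jp0l v : 0 ** v = 0.
Proof. exact: linear0l. Qed.
Lemma jp0r v : v ** 0 = 0.
Proof. exact: linear0r. Qed.
Definition jpE := (jpDl, jpDr, jpZl, jpZr, jpNl, jpNr, jp0l, jp0r).

(** The part of the Jordan identity at x + z that is linear in z; the difference
    of the identities at x + z and x - z isolates it up to the cubic term. *)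
Lemma jordan_id_quadratic x z w :
  z ** ((x ** x) ** w) + 2 *: (x ** ((x ** z) ** w)) =
  (x ** x) ** (z ** w) + 2 *: ((x ** z) ** (x ** w)).
Proof.
apply: (@dot_ext _ _ dot) => u.
have := congr1 (dot^~ u) (jordan_id (x + z) w).
have := congr1 (dot^~ u) (jordan_id (x - z) w).
have := congr1 (dot^~ u) (jordan_id z w).
rewrite !(jpE, dotE) (jpC z x) => h1 h2 h3; lra.
Qed.

Lemma jordan_id_linear x y z w :
  z ** ((x ** y) ** w) + x ** ((y ** z) ** w) + y ** ((z ** x) ** w) =
  (x ** y) ** (z ** w) + (y ** z) ** (x ** w) + (z ** x) ** (y ** w).
Proof.
apply: (@dot_ext _ _ dot) => u.
have := congr1 (dot^~ u) (jordan_id_quadratic (x + y) z w).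
have := congr1 (dot^~ u) (jordan_id_quadratic x z w).
have := congr1 (dot^~ u) (jordan_id_quadratic y z w).
rewrite !(jpE, dotE) (jpC y x) (jpC z x) => h1 h2 h3; lra.
Qed.

(** The full linearization, read as an identity of operators in one of its
    other variables: multiplication by a product of three elements is a
    polynomial in the multiplications by the factors and by their pairwise
    products. *)
Lemma jp_triple w y z x :
  (w ** (y ** z)) ** x =
  (y ** z) ** (w ** x) + (y ** w) ** (z ** x) + (z ** w) ** (y ** x)
  - y ** (w ** (z ** x)) - z ** (w ** (y ** x)).
Proof.
have := jordan_id_linear x y z w.
rewrite (jpC x y) (jpC x w) => h.
apply: (@dot_ext _ _ dot) => u; move/(congr1 (dot^~ u)): h.
rewrite !dotE (jpC (y ** x)) (jpC (y ** z) w) (jpC x (w ** _)).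
by rewrite (jpC (z ** x) (y ** w)) (jpC (z ** x) w) (jpC (z ** w)) => h; lra.
Qed.

(** Multiplication by c satisfies 2 L^3 - 3 L^2 + L = 0, whence the Peirce
    eigenvalues 0, 1/2 and 1. *)
Lemma peirce_cubic c x : c ** c = c ->
  2 *: (c ** (c ** (c ** x))) = 3 *: (c ** (c ** x)) - c ** x.
Proof.
move=> cc; have := jp_triple c c c x; rewrite !cc => h.
apply: (@dot_ext _ _ dot) => u; move/(congr1 (dot^~ u)): h.
rewrite !dotE => h; lra.
Qed.

Lemma peirce_eigenvalue c x l : c ** c = c -> c ** x = l *: x -> x != 0 ->
  l * (l - 1) * (2 * l - 1) = 0.
Proof.
move=> cc cx x0; have := peirce_cubic x cc; rewrite !(cx, jpE).
move/(congr1 (dot^~ x)); rewrite !dotE => h.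
have p := dot_gt0 dot x0; apply: (mulIf (lt0r_neq0 p)).
lra.
Qed.

(** For x in E_0(c) or E_1(c) the multiplications by x and by c commute; the
    multiplication rules of the Peirce spaces all follow from this. *)
Lemma peirce_commute c x l y : c ** c = c -> c ** x = l *: x -> 2 * l != 1 ->
  c ** (x ** y) = x ** (c ** y).
Proof.
move=> cc cx l1; have := jordan_id_linear c c x y.
rewrite cc (jpC x c) cx !jpE => h.
apply: (@dot_ext _ _ dot) => u; move/(congr1 (dot^~ u)): h.
rewrite !dotE => h.
have l2 : 2 * l - 1 != 0 by rewrite subr_eq0.
by apply: (mulfI l2); lra.
Qed.

Lemma peirce_orthogonal c x y l m : c ** x = l *: x -> c ** y = m *: y ->
  l != m -> dot x y = 0.
Proof.
move=> cx cy lm; have := jp_sym c x y; rewrite cx cy !dotE => h.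
have lm' : l - m != 0 by rewrite subr_eq0.
by apply: (mulfI lm'); lra.
Qed.

Lemma peirce_mul10 c x y : c ** c = c -> c ** x = x -> c ** y = 0 -> x ** y = 0.
Proof.
move=> cc cx cy; have h1 : c ** (x ** y) = x ** (c ** y).
  by apply: (@peirce_commute c x 1); rewrite ?scale1r // mulr1 -subr_eq0 addrK oner_eq0.
have h2 : c ** (y ** x) = y ** (c ** x).
  by apply: (@peirce_commute c y 0); rewrite ?scale0r // mulr0 eq_sym oner_eq0.
by rewrite (jpC x) -{1}cx -h2 (jpC y) h1 cy jp0r.
Qed.

(** The components are polynomials in the multiplication by c applied to x,
    namely the Lagrange polynomials at 1, 1/2 and 0.  Hence an operator that
    commutes with this multiplication and has x as an eigenvector has the
    components as eigenvectors too; this allows splitting successively by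
    several idempotents. *)
Lemma peirce_decomposition c x : c ** c = c ->
  exists x1 xh x0, [/\ x = x1 + xh + x0, c ** x1 = x1, c ** xh = 2^-1 *: xh,
    c ** x0 = 0 &
    forall d m, (forall y, d ** (c ** y) = c ** (d ** y)) -> d ** x = m *: x ->
      [/\ d ** x1 = m *: x1, d ** xh = m *: xh & d ** x0 = m *: x0]].
Proof.
move=> cc; have h := peirce_cubic x cc.
exists (2 *: (c ** (c ** x)) - c ** x), (4 *: (c ** x) - 4 *: (c ** (c ** x))),
  (x - 3 *: (c ** x) + 2 *: (c ** (c ** x))).
have fin u v : (forall w, dot u w = dot v w) -> u = v by exact: dot_ext.
split=> [||||d m dc dx]; last by split; rewrite !(jpE, dc, dx); apply: fin => u;
    rewrite !dotE; lra.
all: by apply: fin => u; move/(congr1 (dot^~ u)): h; rewrite ?jpE !dotE => h; lra.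
Qed.

(** In E_1(c) the unit c is an order unit.  Multiplication by w in E_1(c)
    preserves the three Peirce spaces of c and kills E_0(c), while that by c is
    at least 1/2 on the other two; so t c dominates - w for large t. *)
Lemma peirce1_order_unit c w : c ** c = c -> c ** w = w ->
  exists2 t, 0 <= t & forall z, 0 <= dot (t *: c + w) (z ** z).
Proof.
move=> cc cw; have [B B0 hB'] := quadratic_form_bounded dot (jp (- w)).
have hB u : - dot (w ** u) u <= B * dot u u by rewrite -dotNl -jpNl; apply: hB'.
exists (2 * B) => [|z]; first by rewrite mulr_ge0 // ltW.
rewrite -dotA jpDl jpZl dotDl dotZl.
have [z1 [zh [z0 [ez c1 ch c0 _]]]] := peirce_decomposition z cc.
have wcom y : c ** (w ** y) = w ** (c ** y).
  by apply: (@peirce_commute c w 1); rewrite ?scale1r // mulr1 -subr_eq0 addrK oner_eq0.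
have wz0 : w ** z0 = 0 by apply: (@peirce_mul10 c).
have n1h : (1 : R) != 2^-1 by apply/eqP; lra.
have n10 : (1 : R) != 0 by exact: oner_neq0.
have nh0 : (2^-1 : R) != 0 by apply/eqP; lra.
have c1' : c ** z1 = 1 *: z1 by rewrite scale1r.
have c0' : c ** z0 = 0 *: z0 by rewrite scale0r.
have w1' : c ** (w ** z1) = 1 *: (w ** z1) by rewrite wcom c1 scale1r.
have wh' : c ** (w ** zh) = 2^-1 *: (w ** zh) by rewrite wcom ch jpZr.
have o1 := peirce_orthogonal c1' ch n1h.
have o2 := peirce_orthogonal c1' c0' n10.
have o3 := peirce_orthogonal ch c0' nh0.
have o4 := peirce_orthogonal w1' ch n1h.
have o5 := peirce_orthogonal w1' c0' n10.
have o6 := peirce_orthogonal wh' c0' nh0.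
have o7 : dot (w ** zh) z1 = 0 by rewrite jp_sym dotC.
have b1 := hB z1; have bh := hB zh.
move: b1 bh; rewrite ez !jpE c1 ch c0 wz0 !dotE (dotC _ zh z1) o1 o2 o3 o4 o5 o6 o7.
have := mulr_ge0 (ltW B0) (dot_ge0 dot z1); lra.
Qed.

(** The identity P_(z^2) = (P_z)^2 for the quadratic representation
    P_z = 2 L_z^2 - L_(z^2). *)
Lemma quadratic_rep_square z u (P := fun v => 2 *: (z ** (z ** v)) - (z ** z) ** v) :
  2 *: ((z ** z) ** ((z ** z) ** u)) - ((z ** z) ** (z ** z)) ** u = P (P u).
Proof.
rewrite /P jp_triple.
have h v := jp_triple z z z v.
have com v := jordan_id z v.
rewrite !h !jpE !com.
apply: (@dot_ext _ _ dot) => v; rewrite !dotE; lra.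
Qed.
End Jordan.

(** * Self-dual cones of squares and their extreme rays *)

Section SymmetricCone.
Variables (R : realType) (E : vectType R) (dot : {dot E for idfun}).
Variables (jp : {bilinear E -> E -> E}) (e : E) (K : set E).
Hypothesis jordan : euclidean_jordan_algebra dot jp e.
Hypothesis squares : [set jp x x | x in setT] = K.
Hypothesis selfdual : self_dual dot K.
Implicit Types (a t : R) (u v w x y z c d : E).
Local Notation "x ** y" := (jp x y) (at level 40, left associativity).

Lemma cone_square z : K (z ** z).
Proof. by rewrite -squares; exists z. Qed.

Lemma cone_idempotent c : c ** c = c -> K c.
Proof. by move=> <-; apply: cone_square. Qed.

Lemma coneP x : (forall z, K z -> 0 <= dot x z) -> K x.
Proof. by move=> h; rewrite selfdual. Qed.

Lemma cone_sqP x : (forall z, 0 <= dot x (z ** z)) -> K x.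
Proof. by move=> h; apply: coneP => z; rewrite -squares => -[y _ <-]. Qed.

Lemma cone_dot_ge0 x y : K x -> K y -> 0 <= dot x y.
Proof. by move=> hx hy; move: hx; rewrite {1}selfdual => -[_]; apply. Qed.

Lemma coneD x y : K x -> K y -> K (x + y).
Proof.
by move=> hx hy; apply: coneP => z hz; rewrite dotDl addr_ge0 // cone_dot_ge0.
Qed.

Lemma coneZ a x : 0 <= a -> K x -> K (a *: x).
Proof.
by move=> a0 hx; apply: coneP => z hz; rewrite dotZl mulr_ge0 // cone_dot_ge0.
Qed.

Lemma cone_operator_psd d u : K d -> 0 <= dot (d ** u) u.
Proof. by move=> hd; rewrite (dotA jordan) cone_dot_ge0 //; apply: cone_square. Qed.

(** If y = z^2, then c . z^2 = (c z) . z vanishes, so c z = 0 as multiplication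
    by c is positive semidefinite; and E_0(c) is closed under multiplication
    by z. *)
Lemma idempotent_orthogonal_mul c y : c ** c = c -> K y -> dot c y = 0 ->
  c ** y = 0.
Proof.
move=> cc; rewrite -{1}squares => -[z _ <-] h.
have cz : c ** z = 0.
  apply: (@psd_kernel _ _ dot (jp c)) => [u v|u|].
  - exact: (jp_sym jordan).
  - by apply: cone_operator_psd; apply: cone_idempotent.
  - by rewrite (dotA jordan).
rewrite (@peirce_commute _ _ _ _ _ jordan c z 0) ?cz ?scale0r ?linear0r //.
by rewrite mulr0 eq_sym oner_eq0.
Qed.

Lemma cone_idempotent_add c w : c ** c = c -> c ** w = w ->
  exists2 t, 0 <= t & K (t *: c + w).
Proof.
move=> cc cw; have [t t0 ht] := peirce1_order_unit jordan cc cw.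
by exists t => //; apply: cone_sqP.
Qed.

(** As d = z^2, P_d = (P_z)^2 is positive semidefinite, so
    L_(d^2) <= 2 L_d^2 <= 2 B L_d, where B bounds L_d; tested against squares,
    this says that 2 B d - d^2 lies in K. *)
Lemma cone_square_dominated d : K d -> exists2 B, 0 <= B & K (B *: d - d ** d).
Proof.
move=> hd; have [B B0 hB] := @psd_square_bounded _ _ dot (jp d)
  (jp_sym jordan d) (fun u => cone_operator_psd u hd).
exists (2 * B); first by rewrite mulr_ge0 // ltW.
apply: cone_sqP => u; rewrite -(dotA jordan) linearBl linearZl_LR /=.
rewrite !dotE; have := hB u.
have [z _ ez] : [set jp x x | x in setT] d by rewrite squares.
have : 0 <= dot (2 *: (d ** (d ** u)) - (d ** d) ** u) u.
  rewrite -ez (quadratic_rep_square jordan).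
  have Psym v w : dot (2 *: (z ** (z ** v)) - (z ** z) ** v) w =
                  dot v (2 *: (z ** (z ** w)) - (z ** z) ** w).
    by rewrite !dotE !(jp_sym jordan).
  by rewrite Psym dot_ge0.
rewrite !dotE (jp_sym jordan d (d ** u)); lra.
Qed.

(** Extremality applied to 2 B d = (2 B d - d^2) + d^2 makes d^2 a multiple l d
    of d, so that d / l is idempotent.  For w in its Peirce 1-space, both
    t d / l + w and s d / l - w lie in K for large s and t; they sum to a
    multiple of d, so w lies on the line through d. *)
Lemma extreme_ray_primitive d : generates_extreme_ray K d ->
  exists2 l, 0 < l & d ** d = l *: d /\
    forall w, d ** w = l *: w -> exists s, w = s *: d.
Proof.
move=> [d0 Kd extr].
have [B B0 hB] := cone_square_dominated Kd.
have [] := extr _ _ hB (cone_square d); first by exists B; rewrite // subrK.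
move=> _ [l l0 dd]; have lN0 : l != 0.
  apply: contra_neq d0 => l0'; apply: (@dot_eq0 _ _ dot).
  have := dotA jordan d d e.
  by rewrite dd l0' scale0r dot0l (jpC jordan d e) (jp1l jordan).
have l_gt0 : 0 < l by rewrite lt_def lN0.
exists l => //; split=> // w dw.
have cc : (l^-1 *: d) ** (l^-1 *: d) = l^-1 *: d.
  by rewrite linearZl_LR linearZr_LR /= dd scalerK.
have cw : (l^-1 *: d) ** w = w.
  by rewrite linearZl_LR /= dw scalerK.
have cNw : (l^-1 *: d) ** (- w) = - w by rewrite linearNr cw.
have [t t0 Kt] := cone_idempotent_add cc cw.
have [s s0 Ks] := cone_idempotent_add cc cNw.
have [] := extr _ _ Kt Ks.
  exists ((t + s) * l^-1); first by rewrite mulr_ge0 ?addr_ge0 // invr_ge0 ltW.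
  by rewrite addrACA subrr addr0 -scalerDl scalerA.
move=> [a _ ea] _; exists (a - t * l^-1).
by rewrite scalerBl -ea scalerA addrC addKr.
Qed.
End SymmetricCone.

(** * Cyclic indices *)

(** Indices are kept in the form a + k with k = 0, ..., 4, relative to a base
    point a, so that the cyclic symmetry needs no case distinction. *)
Lemma Z5_addE (a : 'Z_5) :
  ((a + 1 + 1 = a + 2) * (a + 1 + 2 = a + 3) * (a + 1 + 3 = a + 4) * (a + 1 + 4 = a) *
   (a + 2 + 1 = a + 3) * (a + 2 + 2 = a + 4) * (a + 2 + 3 = a) * (a + 2 + 4 = a + 1) *
   (a + 3 + 1 = a + 4) * (a + 3 + 2 = a) * (a + 3 + 3 = a + 1) * (a + 3 + 4 = a + 2) *
   (a + 4 + 1 = a) * (a + 4 + 2 = a + 1) * (a + 4 + 3 = a + 2) * (a + 4 + 4 = a + 3)).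
Proof.
have e k l m : k + l = m -> a + k + l = a + m by move=> <-; rewrite addrA.
have e0 k l : k + l = 0 -> a + k + l = a by move=> h; rewrite -addrA h addr0.
by do !split; (apply: e + apply: e0); apply: val_inj.
Qed.

Lemma Z5_rotate (a : 'Z_5) (P : 'Z_5 -> Prop) :
  P a -> P (a + 1) -> P (a + 2) -> P (a + 3) -> P (a + 4) -> forall i, P i.
Proof.
move=> p0 p1 p2 p3 p4 i; rewrite -(subrKC a i); move: (i - a) => k.
have e l : k = l -> P (a + l) -> P (a + k) by move=> ->.
by case: k e => -[|[|[|[|[|//]]]]] kP e;
  [apply: (e 0); rewrite ?addr0 // | apply: (e 1) | apply: (e 2) | apply: (e 3)
  | apply: (e 4)] => //; apply: val_inj.
Qed.

Lemma Z5_sum (V : nmodType) (F : 'Z_5 -> V) a :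
  \sum_i F i = F a + F (a + 1) + F (a + 2) + F (a + 3) + F (a + 4).
Proof.
rewrite (reindex_inj (addrI a)) /= -!addrA 5!big_ord_recl big_ord0 /= !addr0.
by do ![congr (_ + _)]; congr F; try congr (a + _); apply: val_inj => //=; rewrite addn0 modn_small.
Qed.

(** * The trace inner product and spanning families *)

Section Trace.
Variables (R : realType) (E : vectType R) (dot : {dot E for idfun}).

Lemma trace_dot_tensor (a b : E) (A : 'End(E)) :
  trace_dot (tensor dot a b) A = dot b (A a).
Proof.
pose s := vbasis {:E}.
have bs : basis_of {:E} s by exact: vbasisP.
rewrite /trace_dot /mxtrace.
transitivity (\sum_(i < \dim {:E}) dot b (A s`_i) * coord s i a).
  apply: eq_bigr => i _.
  by rewrite !mxE /= passmx.vecof_delta comp_lfunE tensorE linearZ.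
rewrite {2}(coord_basis bs (memvf a)) linear_sum dot_sumr.
by apply: eq_bigr => i _; rewrite linearZ /= dotZr mulrC.
Qed.

Lemma trace_dot_linear (k : R) (B C A : 'End(E)) :
  trace_dot (k *: B + C) A = k * trace_dot B A + trace_dot C A.
Proof.
by rewrite /trace_dot comp_lfunDl -comp_lfunZl passmx.mxof_linear mxtraceD mxtraceZ.
Qed.

Lemma trace_dot0 (A : 'End(E)) : trace_dot 0 A = 0.
Proof.
have := trace_dot_linear (-1) 0 0 A.
by rewrite scaler0 addr0 mulN1r addNr.
Qed.

Lemma trace_dot_sum (I : Type) (s : seq I) (F : I -> 'End(E)) A :
  trace_dot (\sum_(i <- s) F i) A = \sum_(i <- s) trace_dot (F i) A.
Proof.
elim/big_rec2: _ => [|i x B _ <-]; first exact: trace_dot0.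
by rewrite -[F i]scale1r trace_dot_linear mul1r scale1r.
Qed.

Lemma trace_dotZ (k : R) (B A : 'End(E)) :
  trace_dot (k *: B) A = k * trace_dot B A.
Proof. by have := trace_dot_linear k B 0 A; rewrite addr0 trace_dot0 addr0. Qed.
End Trace.

(** A finite sequence in P whose span has the largest possible dimension
    spans P. *)
Lemma finite_spanning (F : fieldType) (V : vectType F) (P : set V) :
  exists s : seq V, (forall v, v \in s -> P v) /\
    forall v, P v -> v \in <<s>>%VS.
Proof.
pose Q n := `[< exists s : seq V, (forall v, v \in s -> P v) /\ (\dim <<s>> = n)%N >].
have Q0 : exists n, Q n.
  by exists (\dim <<[::] : seq V>>); apply/asboolP; exists [::].
have Qmax n : Q n -> (n <= \dim {:V})%N.
  by move=> /asboolP[s [_ <-]]; apply: dimvS; apply: subvf.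
case: (ex_maxnP Q0 Qmax) => n /asboolP[s [Ps ds]] nmax.
exists s; split=> // v Pv.
have /nmax : Q (\dim <<v :: s>>).
  by apply/asboolP; exists (v :: s); split=> // w; rewrite inE => /predU1P[->|/Ps].
rewrite -ds span_cons => h.
have : (<<s>> == <[v]> + <<s>>)%VS.
  by rewrite eqEdim addvSr.
by move=> /eqP ->; apply: (subvP (addvSl _ _)); exact: memv_line.
Qed.

(** * The Horn form *)

(** The form equals (y0 - y1 + y2 + y3 - y4)^2 + 4 y1 y3 + 4 y2 (y4 - y3), and
    also (y0 - y1 + y2 - y3 + y4)^2 + 4 y1 y4 + 4 y0 (y3 - y4); one of the two
    has only nonnegative terms, according to the order of y3 and y4. *)
Lemma horn_form_ge0 (R : realType) (y0 y1 y2 y3 y4 : R) :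
  0 <= y0 -> 0 <= y1 -> 0 <= y2 -> 0 <= y3 -> 0 <= y4 ->
  0 <= y0 ^+ 2 + y1 ^+ 2 + y2 ^+ 2 + y3 ^+ 2 + y4 ^+ 2
    - 2 * (y0 * y1 + y1 * y2 + y2 * y3 + y3 * y4 + y4 * y0)
    + 2 * (y0 * y2 + y1 * y3 + y2 * y4 + y3 * y0 + y4 * y1).
Proof.
move=> h0 h1 h2 h3 h4; have [h34|/ltW h43] := leP y3 y4.
  have := sqr_ge0 (y0 - y1 + y2 + y3 - y4); have := mulr_ge0 h1 h3.
  have := mulr_ge0 h2 (_ : 0 <= y4 - y3); rewrite subr_ge0 => /(_ h34); lra.
have := sqr_ge0 (y0 - y1 + y2 - y3 + y4); have := mulr_ge0 h1 h4.
have := mulr_ge0 h0 (_ : 0 <= y3 - y4); rewrite subr_ge0 => /(_ h43); lra.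
Qed.

Section HornForm.
Variables (R : realType) (E : vectType R) (dot : {dot E for idfun}).
Variable delta : 'Z_5 -> E.
Local Notation H := (horn dot delta).
Local Notation "x $[ i ]" := (dot (delta i) x) (at level 2, format "x $[ i ]").

Lemma horn_dot (a : 'Z_5) z x :
  let zc (k : 'Z_5) := z$[a + k] in let xc (k : 'Z_5) := x$[a + k] in
  dot z (H x) = z$[a] * x$[a] + zc 1 * xc 1 + zc 2 * xc 2 + zc 3 * xc 3 + zc 4 * xc 4
  - (z$[a] * xc 1 + zc 1 * x$[a] + zc 1 * xc 2 + zc 2 * xc 1 + zc 2 * xc 3
     + zc 3 * xc 2 + zc 3 * xc 4 + zc 4 * xc 3 + zc 4 * x$[a] + z$[a] * xc 4)
  + (z$[a] * xc 2 + zc 2 * x$[a] + zc 1 * xc 3 + zc 3 * xc 1 + zc 2 * xc 4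
     + zc 4 * xc 2 + zc 3 * x$[a] + z$[a] * xc 3 + zc 4 * xc 1 + zc 1 * xc 4).
Proof.
move=> zc xc; rewrite /horn !add_lfunE opp_lfunE !sum_lfunE !(Z5_sum _ a).
rewrite !add_lfunE !tensorE !dotE !(dotC dot z) -!/(zc _) -!/(xc _) !Z5_addE.
rewrite -!/(zc _) -!/(xc _); ring.
Qed.

Lemma horn_self_adjoint : self_adjoint dot H.
Proof. by move=> x y; rewrite dotC !(horn_dot 0) /=; ring. Qed.

Lemma horn_ge0 x : (forall i, 0 <= x$[i]) -> 0 <= dot x (H x).
Proof.
move=> x0; rewrite (horn_dot 0) /=.
by have := horn_form_ge0 (x0 0) (x0 (0 + 1)) (x0 (0 + 2)) (x0 (0 + 3)) (x0 (0 + 4)); lra.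
Qed.

(** Where the coordinates a and a + 1 vanish, the Horn form is the square of the
    linear form in the third hypothesis. *)
Lemma horn_zero a x : x$[a] = 0 -> x$[a + 1] = 0 ->
  x$[a + 2] - x$[a + 3] + x$[a + 4] = 0 -> dot x (H x) = 0.
Proof.
move=> h0 h1 h; rewrite (horn_dot a) /= h0 h1.
have -> : x$[a + 3] = x$[a + 2] + x$[a + 4] by lra.
ring.
Qed.
End HornForm.

(** * Joint Peirce decomposition *)

Section JointPeirce.
Variables (R : realType) (E : vectType R) (dot : {dot E for idfun}).
Variables (jp : {bilinear E -> E -> E}) (e : E).
Hypothesis jordan : euclidean_jordan_algebra dot jp e.
Variables (I : eqType) (c : I -> E).
Hypothesis idem : forall i, jp (c i) (c i) = c i.
Hypothesis orth : forall i j, i != j -> jp (c i) (c j) = 0.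

Lemma orthogonal_idempotents_commute i j x :
  jp (c i) (jp (c j) x) = jp (c j) (jp (c i) x).
Proof.
have [->//|ij] := eqVneq i j.
apply: (@peirce_commute _ _ _ _ _ jordan (c i) (c j) 0); rewrite ?idem ?scale0r ?(orth ij) //.
by rewrite mulr0 eq_sym oner_eq0.
Qed.

(** The joint eigenvectors span E, as the components of a Peirce decomposition
    inherit the eigenvalues for the other idempotents. *)
Lemma joint_peirce_ind (s : seq I) (P : E -> Prop) :
  (forall x y, P x -> P y -> P (x + y)) ->
  (forall v, (forall i, i \in s -> exists m, jp (c i) v = m *: v) -> P v) ->
  forall v, P v.
Proof.
move=> PD Ps v.
(* t lists the idempotents for which v has not yet been split *)
suff: forall (t : seq I) v,
    (forall i, i \in s -> i \notin t -> exists m, jp (c i) v = m *: v) -> P v.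
  by move=> /(_ s); apply => i ->.
move=> {v}; elim=> [v hv|i t IH v hv]; first by apply: Ps => i si; apply: hv.
have [v1 [vh [v0 [ev h1 hh h0 hj]]]] := peirce_decomposition jordan v (idem i).
have other j : j \in s -> j \notin t -> j != i -> exists m,
    [/\ jp (c j) v1 = m *: v1, jp (c j) vh = m *: vh & jp (c j) v0 = m *: v0].
  move=> js jt ji; have [|m hm] := hv j js; first by rewrite inE negb_or ji.
  by exists m; apply: hj hm => y; apply: orthogonal_idempotents_commute.
rewrite ev; apply: (PD); first apply: (PD).
all: apply: IH => // j js jt; have [->|ji] := eqVneq j i.
- by exists 1; rewrite scale1r.
- by have [m [? ? ?]] := other j js jt ji; exists m.
- by exists 2^-1.
- by have [m [? ? ?]] := other j js jt ji; exists m.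
- by exists 0; rewrite scale0r.
- by have [m [? ? ?]] := other j js jt ji; exists m.
Qed.

(** Three nonzero eigenvalues would be at least 1/2 each, and their sum, at
    least 3/2, would be an eigenvalue of the idempotent c i + c j + c k. *)
Lemma joint_peirce_support (i j k : I) v (mi mj mk : R) :
  i != j -> i != k -> j != k -> v != 0 ->
  jp (c i) v = mi *: v -> jp (c j) v = mj *: v -> jp (c k) v = mk *: v ->
  [|| mi == 0, mj == 0 | mk == 0].
Proof.
move=> ij ik jk v0 hi hj hk.
have half l m : jp (c l) v = m *: v -> m != 0 -> 2^-1 <= m.
  move=> lm m0; have := peirce_eigenvalue jordan (idem l) lm v0.
  rewrite -mulrA => /eqP; rewrite mulf_eq0 (negPf m0) /= mulf_eq0.
  by move=> /orP[/eqP h|/eqP h]; lra.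
apply: contraT; rewrite !negb_or => /and3P[/(half _ _ hi) h1 /(half _ _ hj) h2 /(half _ _ hk) h3].
have fv : jp (c i + c j + c k) v = (mi + mj + mk) *: v.
  by rewrite !linearDl /= hi hj hk -!scalerDl.
have ff : jp (c i + c j + c k) (c i + c j + c k) = c i + c j + c k.
  rewrite !linearDl !linearDr /= !idem (orth ij) (orth ik) (orth jk).
  by rewrite !(orth (_ : _ != _)) 1?eq_sym // !addr0 !add0r.
have := peirce_eigenvalue jordan ff fv v0.
set m := mi + mj + mk => m0; have m1 : 3 / 2 <= m by rewrite /m; lra.
have : 0 < m * (m - 1) * (2 * m - 1) by rewrite !mulr_gt0 //; lra.
by rewrite m0 ltxx.
Qed.
End JointPeirce.

(** * Copositive forms vanishing at the zeros of the Horn form *)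

Section HornExposed.
Variables (R : realType) (E : vectType R) (dot : {dot E for idfun}).
Variables (jp : {bilinear E -> E -> E}) (e : E) (K : set E).
Hypothesis jordan : euclidean_jordan_algebra dot jp e.
Hypothesis squares : [set jp x x | x in setT] = K.
Hypothesis selfdual : self_dual dot K.
Variables (delta c : 'Z_5 -> E) (kappa : 'Z_5 -> R).
Hypothesis kappa_gt0 : forall i, 0 < kappa i.
Hypothesis deltaE : forall i, delta i = kappa i *: c i.
Hypothesis c_neq0 : forall i, c i != 0.
Hypothesis idem : forall i, jp (c i) (c i) = c i.
Hypothesis orth : forall i j, i != j -> jp (c i) (c j) = 0.
Hypothesis peirce1_line : forall i w, jp (c i) w = w -> exists s, w = s *: c i.
Implicit Types (i j a : 'Z_5) (x y w v : E) (A : 'End(E)).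

Local Notation "x ** y" := (jp x y) (at level 40, left associativity).
Local Notation H := (horn dot delta).
Local Notation "x $[ i ]" := (dot (delta i) x) (at level 2, format "x $[ i ]").

Let jC := jpC jordan.
Let Kdot := cone_dot_ge0 selfdual.
Let KD := coneD selfdual.
Let KZ := coneZ selfdual.

Lemma frame_cone i : K (c i).
Proof. exact: (cone_idempotent squares). Qed.

Lemma coord_ge0 i x : K x -> 0 <= x$[i].
Proof. by move=> Kx; rewrite deltaE dotZl mulr_ge0 ?(ltW (kappa_gt0 i)) ?Kdot //; apply: frame_cone. Qed.

Lemma coord_eq0 i x : c i ** x = 0 -> x$[i] = 0.
Proof.
by move=> cx; rewrite deltaE dotZl -(idem i) (dotA jordan) cx dot0r mulr0.
Qed.

(** The basis, dual to delta, of the span of the c i. *)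
Definition dual_vec i : E := (kappa i * dot (c i) (c i))^-1 *: c i.
Local Notation g := dual_vec.

Lemma dual_scale_gt0 i : 0 < kappa i * dot (c i) (c i).
Proof. by rewrite mulr_gt0 // dot_gt0. Qed.

Lemma frame_dual_vec i : c i = (kappa i * dot (c i) (c i)) *: g i.
Proof. by rewrite scalerA divff ?scale1r // lt0r_neq0 // dual_scale_gt0. Qed.

Lemma frame_mul_dual_vec i j : i != j -> c i ** g j = 0.
Proof. by move=> ij; rewrite linearZr_LR /= orth // scaler0. Qed.

Lemma coord_dual_vec i j : (g j)$[i] = (i == j)%:R.
Proof.
have [->|ij] := eqVneq i j; last by rewrite coord_eq0 // frame_mul_dual_vec.
by rewrite deltaE dotZl dotZr mulrCA mulVf // lt0r_neq0 // dual_scale_gt0.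
Qed.

(** The span V_a of the face of K orthogonal to delta a and delta (a + 1). *)
Definition face_span a x := c a ** x = 0 /\ c (a + 1) ** x = 0.

(** The unit of the subalgebra [face_span a].  Its Peirce 0-space is
    E_1(c a + c (a + 1)), the span of the complementary face, so membership in
    the latter is written [face_unit a ** w = 0]. *)
Definition face_unit a := e - c a - c (a + 1).

(** The hyperplane whose equation, squared, is the Horn form on [face_span a]. *)
Definition horn_kernel a x := x$[a + 2] - x$[a + 3] + x$[a + 4] = 0.

Lemma Z5_neq a (k l : 'Z_5) : k != l -> a + k != a + l.
Proof. by rewrite (inj_eq (addrI a)). Qed.

Lemma Z5_neq0 a (k : 'Z_5) :
  k != 0 -> (a == a + k = false) * (a + k == a = false).
Proof.
by move=> k0; rewrite [a + k == a]eq_sym -{1 3}(addr0 a) (inj_eq (addrI a)) eq_sym (negPf k0).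
Qed.

Lemma face_span_comb a (r s : R) x y : face_span a x -> face_span a y -> face_span a (r *: x + s *: y).
Proof.
by move=> [h1 h2] [h3 h4]; split;
  rewrite linearDr /= !linearZr_LR /= ?h1 ?h2 ?h3 ?h4 !scaler0 addr0.
Qed.

Lemma horn_kernel_comb a (r s : R) x y :
  horn_kernel a x -> horn_kernel a y -> horn_kernel a (r *: x + s *: y).
Proof.
rewrite /horn_kernel !dotE => h1 h2.
transitivity (r * (x$[a + 2] - x$[a + 3] + x$[a + 4]) +
  s * (y$[a + 2] - y$[a + 3] + y$[a + 4])); first by ring.
by rewrite h1 h2 !mulr0 addr0.
Qed.

Lemma face_unit_idem a : face_unit a ** face_unit a = face_unit a.
Proof.
have o : c a ** c (a + 1) = 0 by rewrite orth // Z5_neq0.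
rewrite /face_unit !jpE !(jp1l jordan) (jC (c a) e) (jC (c (a + 1)) e).
rewrite !(jp1l jordan) !idem (jC (c (a + 1))) o.
by apply: (@dot_ext _ _ dot) => u; rewrite !dotE; ring.
Qed.

Lemma face_unitE a x : face_span a x -> face_unit a ** x = x.
Proof. by move=> [h1 h2]; rewrite /face_unit !linearBl /= (jp1l jordan) h1 h2 !subr0. Qed.

Lemma face_span_frame a i : i != a -> i != a + 1 -> face_span a (c i).
Proof. by move=> i0 i1; split; rewrite orth // eq_sym. Qed.

Lemma face_span_dual_vec a i : i != a -> i != a + 1 -> face_span a (g i).
Proof. by move=> i0 i1; split; rewrite frame_mul_dual_vec // eq_sym. Qed.

(** The idempotent completing the c i to the unit; it vanishes when the c i
    already form a Jordan frame. *)
Definition rest := e - \sum_i c i.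

Lemma frame_mul_rest i : c i ** rest = 0.
Proof.
rewrite /rest linearBr /= (jC (c i) e) (jp1l jordan) linear_sumr /=.
rewrite (bigD1 i) //= idem big1 ?addr0 ?subrr // => j ji.
by rewrite orth // eq_sym.
Qed.

Lemma rest_cone : K rest.
Proof.
apply: (cone_idempotent squares); rewrite {1}/rest linearBl /= (jp1l jordan).
by rewrite linear_sumlz big1 ?subr0 // => i _; apply: frame_mul_rest.
Qed.

Lemma dual_vec_cone i : K (g i).
Proof. by apply: KZ (frame_cone i); rewrite invr_ge0 ltW // dual_scale_gt0. Qed.

Lemma face_unit_split a : face_unit a = c (a + 2) + c (a + 3) + c (a + 4) + rest.
Proof.
rewrite /face_unit /rest (Z5_sum _ a).
by apply: (@dot_ext _ _ dot) => u; rewrite !dotE; ring.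
Qed.

(** A zero of the Horn form in the relative interior of the face orthogonal to
    delta a and delta (a + 1): its three remaining coordinates are 1, 2, 1. *)
Definition face_center a := g (a + 2) + 2 *: g (a + 3) + g (a + 4) + rest.

Lemma face_span_center a : face_span a (face_center a).
Proof.
have o k : k != 0 -> k != 1 -> face_span a (g (a + k)).
  by move=> k0 k1; apply: face_span_dual_vec; [rewrite Z5_neq0 | exact: Z5_neq].
have [[h1 h2] [h3 h4] [h5 h6]] := And3 (o 2 isT isT) (o 3 isT isT) (o 4 isT isT).
by split; rewrite /face_center 3!jpDr (jpZr _ 2) frame_mul_rest ?h1 ?h2 ?h3 ?h4 ?h5 ?h6 ?scaler0 ?addr0.
Qed.

Lemma coord_center a i :
  (face_center a)$[i] = (i == a + 2)%:R + 2 * (i == a + 3)%:R + (i == a + 4)%:R.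
Proof.
rewrite /face_center 3!dotDr (dotZr _ 2) !coord_dual_vec.
by rewrite (coord_eq0 (frame_mul_rest i)) addr0.
Qed.

Lemma horn_kernel_center a : horn_kernel a (face_center a).
Proof. by rewrite /horn_kernel !coord_center !(inj_eq (addrI a)) /=; lra. Qed.

Lemma face_center_interior a :
  exists2 M, 0 <= M & forall N, M <= N -> K (N *: face_center a - face_unit a).
Proof.
pose s i := kappa i * dot (c i) (c i).
have s0 i : 0 < s i := dual_scale_gt0 i.
(* N must dominate each coefficient of the unit in terms of the dual vectors *)
exists (s (a + 2) + s (a + 3) + s (a + 4) + 1); first by rewrite !addr_ge0 // ltW.
move=> N hN.
have -> : N *: face_center a - face_unit a = (N - s (a + 2)) *: g (a + 2)
   + (2 * N - s (a + 3)) *: g (a + 3) + (N - s (a + 4)) *: g (a + 4) + (N - 1) *: rest.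
  rewrite face_unit_split (frame_dual_vec (a + 2)) (frame_dual_vec (a + 3)).
  rewrite (frame_dual_vec (a + 4)) /face_center -/(s _) -/(s _) -/(s _).
  by apply: (@dot_ext _ _ dot) => u; rewrite !dotE; ring.
have := (s0 (a + 2), s0 (a + 3), s0 (a + 4)) => -[[h2 h3] h4].
by do !apply: KD; apply: KZ (dual_vec_cone _) || apply: KZ rest_cone; lra.
Qed.

(** The first-order condition at the minimizer p of the form of A on K: the
    derivative 2 (A p . y) in every direction y of K is nonnegative, and K is
    its own dual. *)
Lemma copositive_zero_image A p :
  copositive_cone dot K A -> K p -> dot p (A p) = 0 -> K (A p).
Proof.
move=> [Asym Acop] Kp Ap0; apply: (coneP selfdual) => y Ky.
have h s : 0 <= s -> 0 <= 2 * s * dot (A p) y + s ^+ 2 * dot y (A y).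
  move=> s0; have := Acop (p + s *: y) (KD Kp (KZ s0 Ky)).
  rewrite linearD linearZ /= !dotE Ap0 -(Asym p y) (dotC dot y (A p)) => hh; lra.
have yy : 0 <= dot y (A y) := Acop y Ky.
rewrite leNgt; apply/negP => Aneg.
set q := dot (A p) y in h Aneg *; set r := dot y (A y) in h yy *.
have r1 : 0 < r + 1 by lra.
(* a step small enough for the linear term to beat the quadratic one *)
have := h (- q / (r + 1)) (divr_ge0 _ (ltW r1)); rewrite oppr_ge0 => /(_ (ltW Aneg)).
suff : 2 * (- q / (r + 1)) * q + (- q / (r + 1)) ^+ 2 * r < 0.
  by rewrite ltNge => /negP.
have -> : 2 * (- q / (r + 1)) * q + (- q / (r + 1)) ^+ 2 * r =
   - (q ^+ 2 * (r + 2) / (r + 1) ^+ 2) by field; apply: lt0r_neq0.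
have q2 : 0 < q ^+ 2 by rewrite exprn_even_gt0 //= lt_eqF.
by rewrite oppr_lt0 (divr_gt0 (mulr_gt0 q2 _)) ?(exprn_gt0 _ r1) //; lra.
Qed.

(** A maps the hyperplane [horn_kernel a] of [face_span a] into the span of the
    complementary face. *)
Definition face_annihilating A := forall a x, face_span a x -> horn_kernel a x ->
  face_unit a ** A x = 0.

(** A vector x of the hyperplane is the difference of N z + x and N z, where z
    is the interior zero [face_center a].  For N large both lie in K and
    dominate the unit of the face, so their images, which lie in K and are
    orthogonal to them, are orthogonal to that unit as well. *)
Lemma copositive_face_annihilating A : copositive_cone dot K A ->
  (forall x, K x -> dot x (H x) = 0 -> dot x (A x) = 0) -> face_annihilating A.
Proof.
move=> Acop Azero a x ox zx; have [M M0 hM] := face_center_interior a.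
have key (N : R) u : face_span a u -> horn_kernel a u -> K (N *: face_center a + u - face_unit a) ->
    face_unit a ** A (N *: face_center a + u) = 0.
  move=> ou zu Kq; set p := N *: face_center a + u in Kq *.
  have Kfu : K (face_unit a) by apply: (cone_idempotent squares); apply: face_unit_idem.
  have Kp : K p by rewrite -(subrK (face_unit a) p); apply: KD.
  have op : face_span a p by rewrite /p -[u]scale1r; apply: face_span_comb (face_span_center a) ou.
  have zp : horn_kernel a p by rewrite /p -[u]scale1r; apply: horn_kernel_comb (horn_kernel_center a) zu.
  have Ap0 : dot p (A p) = 0.
    apply: Azero => //; case: op => h1 h2.
    by apply: (@horn_zero _ _ dot delta a p) => //; apply: coord_eq0.
  have KAp := copositive_zero_image Acop Kp Ap0.
  apply: (idempotent_orthogonal_mul jordan squares selfdual (face_unit_idem a) KAp).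
  have := Kdot Kq KAp; have := Kdot Kfu KAp; rewrite (dotDl _ p) (dotNl _ (face_unit a)) Ap0 => h1 h2.
  by apply/eqP; rewrite eq_le h1 andbT; lra.
have [t t0 ht] := cone_idempotent_add jordan squares selfdual (face_unit_idem a) (face_unitE ox).
pose N := (t + 1) * M.
have MN : M <= N by rewrite /N mulrDl mul1r lerDr mulr_ge0.
have h1 : face_unit a ** A (N *: face_center a + x) = 0.
  apply: key => //.
  have -> : N *: face_center a + x - face_unit a =
      (t + 1) *: (M *: face_center a - face_unit a) + (t *: face_unit a + x).
    by apply: (@dot_ext _ _ dot) => u; rewrite /N !dotE; ring.
  by apply: KD => //; apply: KZ; [lra | apply: hM].
have h2 : face_unit a ** A (N *: face_center a + 0) = 0.
  apply: key; last by rewrite addr0; apply: hM.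
    by split; rewrite linear0r.
  by rewrite /horn_kernel !dot0r; lra.
by move: h1; rewrite (linearD A) linearDr /=; move: h2; rewrite addr0 => ->; rewrite add0r.
Qed.

Lemma horn_copositive : copositive_cone dot K H.
Proof.
split; first exact: horn_self_adjoint.
by move=> x Kx; apply: horn_ge0 => i; apply: coord_ge0.
Qed.

Lemma face_complement_frame a i w : face_unit a ** w = 0 -> i != a -> i != a + 1 ->
  c i ** w = 0.
Proof.
move=> fw ia ia1.
by apply: (peirce_mul10 jordan (face_unit_idem a)) fw; apply: face_unitE; apply: face_span_frame.
Qed.

(** E_1(c a + c (a + 1)) and E_1(c (a + 1) + c (a + 2)) meet in the Peirce
    1-space of the common idempotent c (a + 1), which is a line. *)
Lemma face_complement_inter a w : face_unit a ** w = 0 -> face_unit (a + 1) ** w = 0 ->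
  dot (c (a + 1)) w = 0 -> w = 0.
Proof.
move=> f0 f1 cw0.
have ca : c a ** w = 0.
  by apply: (face_complement_frame f1); rewrite ?Z5_addE Z5_neq0.
have cw : c (a + 1) ** w = w.
  apply/esym/eqP; rewrite -subr_eq0 -f0 /face_unit !linearBl /= (jp1l jordan) ca.
  by rewrite subr0.
have [s ws] := peirce1_line cw; move: cw0; rewrite ws dotZr => /eqP; rewrite mulf_eq0.
by rewrite (gt_eqF (dot_gt0 _ _)) // orbF => /eqP ->; rewrite scale0r.
Qed.

(** This zero of the Horn form lies on two of the faces, with coordinates
    (0, 1, 1) and (1, 1, 0). *)
Lemma face_span_adjacent a : let x := g a + g (a + 1) in
  [/\ face_span (a + 2) x, horn_kernel (a + 2) x, face_span (a + 3) x & horn_kernel (a + 3) x].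
Proof.
move=> x; rewrite /face_span /horn_kernel /x !linearDr /= !coord_dual_vec !Z5_addE.
rewrite !(inj_eq (addrI a)) !eqxx !Z5_neq0 //= !frame_mul_dual_vec ?Z5_neq ?Z5_neq0 //.
by rewrite addr0; do !split; lra.
Qed.

Lemma face_span_triple a : let x := g a + 2 *: g (a + 1) + g (a + 2) in
  face_span (a + 3) x /\ horn_kernel (a + 3) x.
Proof.
move=> x; rewrite /face_span /horn_kernel /x !dotDr !(dotZr _ 2) !coord_dual_vec !Z5_addE.
rewrite !jpDr !(jpZr _ 2).
rewrite !(inj_eq (addrI a)) !eqxx !Z5_neq0 //= !frame_mul_dual_vec ?Z5_neq ?Z5_neq0 //.
by rewrite scaler0 !addr0; do !split; lra.
Qed.

(** Facial conditions at the zeros with coordinates (1, 1, 0) and (1, 2, 1) are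
    linear relations between neighbouring entries; they determine all the
    entries from a single one. *)
Lemma dual_entries_eq0 D i j : self_adjoint dot D -> face_annihilating D ->
  dot (g 0) (D (g 0)) = 0 -> dot (g i) (D (g j)) = 0.
Proof.
move=> Dsym Df D00.
have gzero k w b : face_unit b ** w = 0 -> k != b -> k != b + 1 -> dot (g k) w = 0.
  move=> fw kb kb1; rewrite dotZl -[X in dot X w]idem (dotA jordan).
  by rewrite (face_complement_frame fw) // dot0r mulr0.
pose B k l := dot (g k) (D (g l)).
have Bsym k l : B k l = B l k by rewrite /B dotC Dsym.
have Badj a : B a a + B a (a + 1) = 0 /\ B (a + 1) a + B (a + 1) (a + 1) = 0.
  have [o2 z2 _ _] := face_span_adjacent a; have f2 := Df _ _ o2 z2.
  by split; rewrite -dotDr -(linearD D); apply: (gzero _ _ _ f2);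
    rewrite ?Z5_addE ?Z5_neq ?Z5_neq0.
have Btri a : B a a + 2 * B a (a + 1) + B a (a + 2) = 0.
  have [o3 z3] := face_span_triple a; have f3 := Df _ _ o3 z3.
  rewrite -(dotZr _ 2) -!dotDr -(linearZ_LR D) -!(linearD D).
  by apply: (gzero _ _ _ f3); rewrite ?Z5_addE ?Z5_neq ?Z5_neq0.
have Bnext a : B a a = 0 -> B (a + 1) (a + 1) = 0.
  by have [] := Badj a; rewrite (Bsym (a + 1) a) => h1 h2 h3; lra.
have B0 a : B a a = 0.
  have b1 := Bnext 0 D00; have b2 := Bnext _ b1.
  have b3 := Bnext _ b2; have b4 := Bnext _ b3; rewrite !Z5_addE in b2 b3 b4.
  exact: (Z5_rotate (a := 0) (P := fun a => B a a = 0)).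
have B1 a : B a (a + 1) = 0 by have [h _] := Badj a; have := B0 a; lra.
have B2 a : B a (a + 2) = 0 by have := Btri a; rewrite B0 B1; lra.
have e3 : j + 3 + 2 = j by rewrite Z5_addE.
have e4 : j + 4 + 1 = j by rewrite Z5_addE.
rewrite -/(B i j); apply: (Z5_rotate (a := j) (P := fun i => B i j = 0)) i => //.
- by rewrite Bsym.
- by rewrite Bsym.
- by rewrite -{2}e3.
- by rewrite -{2}e4.
Qed.

Lemma face_span_image a x : face_unit a ** x = 0 -> face_span (a + 2) x /\ face_span (a + 3) x.
Proof.
move=> fx; rewrite /face_span !Z5_addE.
by do !split; apply: (face_complement_frame fx); rewrite ?(inj_eq (addrI a)) ?Z5_neq0.
Qed.

(** At most two eigenvalues are nonzero, and the complement of two points of a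
    5-cycle contains an adjacent pair. *)
Lemma joint_eigenvector_face_span v : (forall i, exists m, c i ** v = m *: v) -> v != 0 ->
  exists a, face_span a v.
Proof.
move=> ev v0; have [m hm] := choice ev.
have three k l n : k != l -> k != n -> l != n -> [|| m k == 0, m l == 0 | m n == 0].
  by move=> kl kn ln; apply: (joint_peirce_support jordan idem orth kl kn ln v0).
have [a] : exists a, (m a == 0) && (m (a + 1) == 0).
  have t k l n : 0 + k != 0 + l -> 0 + k != 0 + n -> 0 + l != 0 + n ->
    [|| m (0 + k) == 0, m (0 + l) == 0 | m (0 + n) == 0] by exact: three.
  suff : [|| (m (0 + 0) == 0) && (m (0 + 1) == 0), (m (0 + 1) == 0) && (m (0 + 2) == 0),
     (m (0 + 2) == 0) && (m (0 + 3) == 0), (m (0 + 3) == 0) && (m (0 + 4) == 0) |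
     (m (0 + 4) == 0) && (m (0 + 0) == 0)].
    case/or4P => [h|h|h|/orP[h|h]]; [exists 0 | exists (0 + 1) | exists (0 + 2)
      | exists (0 + 3) | exists (0 + 4)]; by rewrite ?Z5_addE ?addr0 // in h *.
  move: (t 0 1 2 isT isT isT) (t 0 1 3 isT isT isT) (t 0 2 3 isT isT isT)
    (t 0 2 4 isT isT isT) (t 1 2 4 isT isT isT) (t 1 3 4 isT isT isT).
  by do 5 case: (m _ == 0).
by move=> /andP[/eqP ma /eqP ma1]; exists a; split; rewrite hm ?ma ?ma1 scale0r.
Qed.

(** D vanishes on the span of the c i, then on the intersections of consecutive
    [face_span]s, then on each of them, and these span E. *)
Lemma face_annihilating_eq0 D : self_adjoint dot D -> face_annihilating D ->
  dot (g 0) (D (g 0)) = 0 -> D = 0.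
Proof.
move=> Dsym Df D00.
have entry i j : dot (g i) (D (g j)) = 0 by exact: dual_entries_eq0.
have gc i j : dot (c i) (D (g j)) = 0.
  by rewrite (frame_dual_vec i) dotZl entry mulr0.
have Dadj a : D (g a) = - D (g (a + 1)).
  apply/eqP; rewrite -addr_eq0 -(linearD D); apply/eqP.
  have [o2 z2 o3 z3] := face_span_adjacent a.
  apply: (@face_complement_inter (a + 2)); first exact: Df.
    by rewrite Z5_addE; apply: Df.
  by rewrite (linearD D) dotDr !gc addr0.
have Dg a : D (g a) = 0.
  (* five sign changes around the cycle *)
  have h : D (g a) = - D (g a).
    rewrite {1}Dadj (Dadj (a + 1)) !Z5_addE (Dadj (a + 2)) Z5_addE.
    by rewrite (Dadj (a + 3)) Z5_addE (Dadj (a + 4)) Z5_addE !opprK.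
  apply: (@dot_ext _ _ dot) => w; move/(congr1 (dot^~ w)): h.
  by rewrite !dotE => h; lra.
have Dc a : D (c a) = 0 by rewrite (frame_dual_vec a) linearZ /= Dg scaler0.
have Dface a x : face_span a x -> face_unit a ** D x = 0.
  move=> ox; pose l := x$[a + 2] - x$[a + 3] + x$[a + 4].
  (* D does not see the correction that moves x into the hyperplane *)
  have og : face_span a (g (a + 2)) by apply: face_span_dual_vec; rewrite ?(inj_eq (addrI a)) ?Z5_neq0.
  have ox' : face_span a (x + (- l) *: g (a + 2)) by rewrite -[x]scale1r; apply: face_span_comb.
  have <- : D (x + (- l) *: g (a + 2)) = D x.
    by rewrite (linearD D) (linearZ_LR D (- l)) /= Dg scaler0 addr0.
  apply: Df => //.
  rewrite /horn_kernel !dotDr !(dotZr _ (- l)) !coord_dual_vec !(inj_eq (addrI a)) /= /l; lra.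
have Dtwo a x : face_span a x -> face_span (a + 1) x -> D x = 0.
  move=> ox ox1; apply: (@face_complement_inter a); try exact: Dface.
  by rewrite -Dsym Dc dot0l.
have Doff a x : face_span a x -> D x = 0.
  move=> ox; apply: (@dot_eq0 _ _ dot); rewrite Dsym.
  have [o2 o3] := face_span_image (Dface _ _ ox).
  by rewrite (Dtwo (a + 2)) ?dot0r // Z5_addE.
apply/lfunP => v; rewrite zero_lfunE.
apply: (joint_peirce_ind jordan idem orth (s := enum 'Z_5) (P := fun v => D v = 0)) v.
  by move=> x y hx hy; rewrite linearD /= hx hy addr0.
move=> v ev; have [->|v0] := eqVneq v 0; first by rewrite linear0.
have [i|a oa] := joint_eigenvector_face_span _ v0; last exact: Doff oa.
by apply: ev; rewrite mem_enum.
Qed.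

Lemma horn_dual_vec : dot (g 0) (H (g 0)) = 1.
Proof. by rewrite (horn_dot dot delta 0) !coord_dual_vec /=; ring. Qed.

(** Both A and H are [face_annihilating], hence so is A - alpha H, where alpha
    is the value of A at a point where H takes the value 1. *)
Lemma horn_zeros_determine A : copositive_cone dot K A ->
  (forall x, K x -> dot x (H x) = 0 -> dot x (A x) = 0) ->
  ray H A.
Proof.
move=> Acop Azero; pose alpha := dot (g 0) (A (g 0)).
have alpha0 : 0 <= alpha by apply: Acop.2; apply: dual_vec_cone.
exists alpha => //; apply/eqP; rewrite -subr_eq0; apply/eqP.
have fA : face_annihilating A := copositive_face_annihilating Acop Azero.
have fH : face_annihilating H :=
  copositive_face_annihilating horn_copositive (fun _ _ h => h).
have DE x : (A - alpha *: H) x = A x - alpha *: H x.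
  by rewrite add_lfunE opp_lfunE scale_lfunE.
apply: face_annihilating_eq0.
- move=> x y; rewrite !DE !dotE.
  by rewrite (Acop.1 x y) (horn_copositive.1 x y).
- move=> a x ox zx; rewrite DE linearBr linearZr_LR /=.
  by rewrite fA // fH // scaler0 subr0.
- by rewrite DE dotDr dotNr (dotZr _ alpha) horn_dual_vec mulr1 subrr.
Qed.

Lemma horn_neq0 : H != 0.
Proof.
apply/eqP => H0; have := horn_dual_vec.
by rewrite H0 zero_lfunE dot0r => /eqP; rewrite eq_sym oner_eq0.
Qed.
End HornExposed.

Unset Implicit Arguments.

Theorem theorem4p6 (R : realType) (E : vectType R) (dot : {dot E for idfun})
    (K : set E) (r : nat) (delta : 'Z_5 -> E) :
  symmetric_cone dot K ->
  cone_rank dot K r ->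
  (5 <= r)%N ->
  (forall i j : 'Z_5, i != j -> dot (delta i) (delta j) = 0) ->
  (forall i : 'Z_5, generates_extreme_ray K (delta i)) ->
  generates_exposed_ray (self_adjoint dot) (@trace_dot R E)
    (copositive_cone dot K) (horn dot delta).
Proof.
move=> [_ _ selfdual _] [jp [e [jordan squares _]]] _ dorth dextr.
have prim i : exists l, [/\ 0 < l, jp (delta i) (delta i) = l *: delta i &
    forall w, jp (delta i) w = l *: w -> exists s, w = s *: delta i].
  by have [l l0 [h1 h2]] := extreme_ray_primitive jordan squares selfdual (dextr i); exists l.
have [kappa hk] := choice prim.
have kappa_gt0 i : 0 < kappa i by have [] := hk i.
have kN0 i : kappa i != 0 by rewrite lt0r_neq0.
pose c i := (kappa i)^-1 *: delta i.
have deltaE i : delta i = kappa i *: c i by rewrite scalerA divff // scale1r.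
have c_neq0 i : c i != 0.
  by rewrite scaler_eq0 invr_eq0 (negPf (kN0 i)) /=; case: (dextr i).
have idem i : jp (c i) (c i) = c i.
  have [_ h _] := hk i.
  by rewrite /c linearZl_LR linearZr_LR /= h scalerK.
have peirce1_line i w : jp (c i) w = w -> exists s, w = s *: c i.
  have [_ _ h] := hk i => cw; have [|s ->] := h w; first by rewrite deltaE linearZl_LR /= cw.
  by exists (s * kappa i); rewrite deltaE scalerA.
have orth i j : i != j -> jp (c i) (c j) = 0.
  move=> ij; apply: (idempotent_orthogonal_mul jordan squares selfdual (idem i)).
    exact: (cone_idempotent squares).
  by rewrite dotZl dotZr dorth // !mulr0.
(* the exposing functional: zeros of the Horn form whose tensor squares span *)
pose Z := [set x | K x /\ dot x (horn dot delta x) = 0].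
have [s [sZ Zs]] := finite_spanning [set tensor dot x x | x in Z].
have dA A : trace_dot (\sum_(B <- s) B) A = \sum_(B <- s) trace_dot B A.
  exact: (trace_dot_sum s id).
have cop := horn_copositive squares selfdual kappa_gt0 deltaE idem.
have sge0 A B : copositive_cone dot K A -> B \in s -> 0 <= trace_dot B A.
  move=> [_ Ac] /sZ[x [Kx _] <-]; rewrite trace_dot_tensor; exact: Ac.
split=> //; first exact: (horn_neq0 jordan kappa_gt0 deltaE c_neq0 idem orth).
exists (\sum_(B <- s) B).
  split=> [x y|A Acop].
    rewrite !sum_lfunE !dot_sumr dotC dot_sumr big_seq [RHS]big_seq.
    apply: eq_bigr => B /sZ[z _ <-]; rewrite !tensorE !dotE (dotC _ y z) (dotC _ z x).
    by rewrite mulrC.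
  by rewrite dA big_seq; apply: sumr_ge0 => B; apply: sge0.
apply/seteqP; split=> [A [a a0 ->]|A [Acop /= tr0]].
  split=> /=.
    split=> [x y|x Kx]; rewrite !scale_lfunE !dotE; first by rewrite cop.1.
    by rewrite mulr_ge0 // cop.2.
  rewrite dA big_seq big1 // => B /sZ[z [Kz z0] <-].
  by rewrite trace_dot_tensor scale_lfunE dotZr z0 mulr0.
apply: (horn_zeros_determine jordan squares selfdual kappa_gt0 deltaE c_neq0 idem orth peirce1_line Acop).
move=> x Kx x0.
have B0 B : B \in s -> trace_dot B A = 0.
  move: tr0; rewrite dA big_seq => /eqP; rewrite psumr_eq0 => [|C]; last exact: sge0.
  by move=> /allP h Bs; have := h B Bs; rewrite Bs => /eqP.
have tx : tensor dot x x \in <<s>>%VS by apply: Zs; exists x.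
rewrite -trace_dot_tensor (@coord_span _ _ _ (in_tuple s) _ tx) trace_dot_sum big1 // => i _.
by rewrite trace_dotZ B0 ?mulr0 // mem_nth.
Qed.
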